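(* Let $\theta,\alpha,\beta>0$ and $p_0,e^0,e^1\in l_2$, and put $e_0=e^0+\theta e^1$. Consider one pursuer $p$ and one evader $e$ moving in $l_2$ according to $$\dot p(t)=a(t),\quad p(0)=p_0,\qquad \dot e(t)=(\theta-t)b(t),\quad e(0)=e_0,\qquad 0\le t\le\theta,$$ where $b:[0,\theta]\to l_2$ has measurable coordinates and satisfies $\|b(t)\|\le\beta$ for $0\le t\le\theta$. Let $$\Delta=\left\{\gamma\in l_2:\ 2\langle e_0-p_0,\gamma\rangle\le\theta^2\left(\alpha^2-\frac{\beta^2\theta^2}{4}\right)+\|e_0\|^2-\|p_0\|^2\right\}.$$ If $e(\theta)\in\Delta$, then the pursuer's strategy $$a(t)=\frac{e_0-p_0}{\theta}+\int_0^\theta\frac{(\theta-r)\,b(r)}{\theta}\,dr,\qquad 0\le t\le\theta,$$ satisfies $\|a(t)\|\le\alpha$ for all $t\in[0,\theta]$ and guarantees $p(\theta)=e(\theta)$.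
   Context: $l_2$ is the real Hilbert space of square-summable sequences, with its standard inner product $\langle\cdot,\cdot\rangle$ and norm $\|\cdot\|$. The number $\alpha$ is the bound on the pursuer's control (a control $a$ is admissible if it has measurable coordinates and $\|a(t)\|\le\alpha$ on $[0,\theta]$) and $\beta$ is the bound on the evader's control. The pursuer is assumed to know $p_0$, $e_0$ and the whole function $b(\cdot)$ at time $0$. The evader's position at time $\theta$ is $e(\theta)=e_0+\int_0^\theta(\theta-t)b(t)\,dt$. *)

(* Defs.v *)
From HB Require Import structures.
From mathcomp Require Import all_boot all_order all_algebra.
From mathcomp Require Import all_classical all_reals all_analysis.
From mathcomp Require Import ring lra.

Set Implicit Arguments.
Unset Strict Implicit.
Unset Printing Implicit Defensive.

Import Order.TTheory GRing.Theory Num.Theory.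
Import numFieldNormedType.Exports.

Local Open Scope classical_set_scope.
Local Open Scope ring_scope.

Definition square_summable (R : realType) : {pred nat -> R} :=
  fun x => `[< cvgn (series (fun k => x k ^+ 2)) >].

Section square_summable_closed.
Variable R : realType.

Let square_summable_submod : submod_closed (@square_summable R).
Proof.
split.
  apply/asboolP; apply: (@nondecreasing_is_cvgn _ _).
    by apply: nondecreasing_series => n _ _; exact: sqr_ge0.
  exists 0 => _ [n _ <-] /=.
  by rewrite /series/= big1// => i _; rewrite expr0n.
move=> a x y /asboolP cx /asboolP cy; apply/asboolP.
apply: (@series_le_cvg _ _
  (fun k => 2 * a ^+ 2 * x k ^+ 2 + 2 * y k ^+ 2)).
- by move=> k; exact: sqr_ge0.
- by move=> k; apply: addr_ge0; do ?[exact: sqr_ge0|exact: ler0n|apply: mulr_ge0].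
- move=> k; rewrite -subr_ge0.
  have -> : 2 * a ^+ 2 * x k ^+ 2 + 2 * y k ^+ 2 - (a *: x + y) k ^+ 2
      = (a * x k - y k) ^+ 2.
    by rewrite (_ : (a *: x + y) k = a * x k + y k)//; ring.
  exact: sqr_ge0.
- rewrite (_ : series _ = (fun n => (2 * a ^+ 2) *
      series (fun k => x k ^+ 2) n + 2 * series (fun k => y k ^+ 2) n)).
    by apply: is_cvgD; apply: is_cvgM => //; exact: is_cvg_cst.
  apply/funext => n; rewrite /series/=.
  by rewrite !mulr_sumr -big_split.
Qed.

HB.instance Definition _ :=
  GRing.isSubmodClosed.Build R (nat -> R) (@square_summable R)
    square_summable_submod.

End square_summable_closed.

Record l2 (R : realType) :=
  L2 { l2_val :> nat -> R; _ : l2_val \in @square_summable R }.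

HB.instance Definition _ (R : realType) := [isSub for @l2_val R].
HB.instance Definition _ (R : realType) := [Choice of l2 R by <:].
HB.instance Definition _ (R : realType) :=
  [SubChoice_isSubLmodule of l2 R by <:].

Definition l2_dot (R : realType) (x y : l2 R) : R :=
  limn (series (fun k => x k * y k)).

Definition l2_norm (R : realType) (x : l2 R) : R := Num.sqrt (l2_dot x x).

(* The real line with the sigma-algebra of Lebesgue-measurable sets (the
   library's default structure on [R] is the Borel sigma-algebra). *)
Definition lebesgue_type (R : realType) : measurableType _ :=
  caratheodory_type ((@wlength R idfun)^*)%mu.

Definition admissible_control (R : realType) (T c : R) (u : R -> l2 R) :=
  (forall k, @measurable_fun _ _ (lebesgue_type R) R `[0, T] (fun t => u t k)) /\
  (forall t, t \in `[0, T] -> l2_norm (u t) <= c).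

(* Coordinatewise Lebesgue integral. The default value 0 is taken only when the
   sequence of integrals is not square-summable; [l2_integralE] below excludes
   this for bounded functions with measurable coordinates. *)
Definition l2_integral (R : realType) (A : set R) (f : R -> l2 R) : l2 R :=
  insubd 0 (fun k => \int[completed_lebesgue_measure]_(t in A) f t k).

(* [x] solves x' = u, x(0) = x0 on [0, T]. As [u] is only assumed measurable,
   the equation is understood in Caratheodory's sense, i.e. integrated. *)
Definition trajectory (R : realType) (T : R) (u : R -> l2 R) (x0 : l2 R)
    (x : R -> l2 R) :=
  forall t, t \in `[0, T] -> x t = x0 + l2_integral `[0, t] u.

Definition Delta (R : realType) (theta alpha beta : R) (p0 e0 : l2 R) :
    set (l2 R) :=
  [set gamma | 2 * l2_dot (e0 - p0) gamma <=
     theta ^+ 2 * (alpha ^+ 2 - beta ^+ 2 * theta ^+ 2 / 4)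
     + l2_norm e0 ^+ 2 - l2_norm p0 ^+ 2].

Definition strategy (R : realType) (theta : R) (p0 e0 : l2 R) (b : R -> l2 R) :
    R -> l2 R :=
  fun _ => theta^-1 *: (e0 - p0) +
    l2_integral `[0, theta] (fun r => ((theta - r) / theta) *: b r).

Section l2_theory.
Variable R : realType.
Implicit Types (x y : l2 R) (u : R -> l2 R).
Notation mu := (@completed_lebesgue_measure R).

Let measurable_itv_completed (i : interval R) :
  @measurable _ (lebesgue_type R) [set` i].
Proof. apply: sub_caratheodory; exact: measurable_itv. Qed.

Let completed_itv t : 0 <= t -> mu `[0, t] = t%:E.
Proof.
move=> t0; rewrite -[LHS]/(lebesgue_measure `[0, t]) lebesgue_measure_itv/=.
by rewrite lte_fin oppr0 adde0; case: ltgtP t0 => // <-.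
Qed.

Lemma l2_sqr_cvg x : cvgn (series (fun k => x k ^+ 2)).
Proof. by case: x => x /= /asboolP. Qed.

Lemma l2_norm_ge0 x : 0 <= l2_norm x.
Proof. exact: sqrtr_ge0. Qed.

Lemma le_sum_l2_norm x n : \sum_(0 <= k < n) x k ^+ 2 <= l2_norm x ^+ 2.
Proof.
have nd : nondecreasing_seq (series (fun k => x k ^+ 2)).
  by apply: nondecreasing_series => k _ _; exact: sqr_ge0.
have E : (fun k => x k * x k) = (fun k => x k ^+ 2) by [].
have le n' : \sum_(0 <= k < n') x k ^+ 2 <= l2_dot x x.
  by rewrite /l2_dot E; apply: (nondecreasing_cvgn_le nd (@l2_sqr_cvg x)).
rewrite /l2_norm sqr_sqrtr//; apply: le_trans (le 0%N).
by rewrite big_geq.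
Qed.

Lemma coord_le_l2_norm x k : `|x k| <= l2_norm x.
Proof.
rewrite -(@ler_pXn2r _ 2)// ?nnegrE ?l2_norm_ge0// real_normK ?num_real//.
apply: le_trans (le_sum_l2_norm x k.+1).
by rewrite big_nat_recr//= lerDr sumr_ge0// => i _; exact: sqr_ge0.
Qed.

Lemma admissible_integrable T c u t k : admissible_control T c u ->
  t \in `[0, T] -> mu.-integrable `[0, t] (EFin \o (fun s => u s k)).
Proof.
move=> [mu_ nu]; rewrite in_itv/= => /andP[t0 tT].
have sub : `[0, t]%classic `<=` `[0, T]%classic.
  by apply: subset_itvl; rewrite bnd_simp.
apply: measurable_bounded_integrable => //.
- by rewrite /= completed_itv// ltry.
- by apply: measurable_funS (mu_ k).
- exists c; split; first exact: num_real.
  move=> M cM s /= st; apply: le_trans (ltW cM).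
  by apply: le_trans (coord_le_l2_norm _ _) (nu _ (sub _ st)).
Qed.

Lemma l2_integralE T c u t k : admissible_control T c u -> t \in `[0, T] ->
  l2_integral `[0, t] u k = \int[mu]_(s in `[0, t]) u s k.
Proof.
move=> au tT; rewrite /l2_integral /insubd insubT//.
have iu j := admissible_integrable j au tT.
move: (tT); rewrite in_itv/= => /andP[t0 tT'].
set v := fun j => _; apply/asboolP.
have S0 n : 0 <= \sum_(0 <= j < n) v j ^+ 2.
  by rewrite sumr_ge0// => j _; exact: sqr_ge0.
apply: nondecreasing_is_cvgn.
  by apply: nondecreasing_series => j _ _; exact: sqr_ge0.
exists ((t * c) ^+ 2) => _ [n _ <-]; rewrite /series/=.
set S := \sum_(0 <= j < n) _; have {S0} := S0 n; rewrite -/S => S0.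
have iZ (a : R) j : mu.-integrable `[0, t] (EFin \o (fun s => a * u s j)).
  exact: (integrableZl (measurable_itv_completed `[0, t]) a (iu j)).
have SE m : mu.-integrable `[0, t]
      (EFin \o (fun s => \sum_(0 <= j < m) v j * u s j)) /\
    \sum_(0 <= j < m) v j ^+ 2 =
      \int[mu]_(s in `[0, t]) (\sum_(0 <= j < m) v j * u s j).
  elim: m => [|m [iS ES]].
    rewrite big_geq// (_ : (fun s => _) = cst 0); last first.
      by apply/funext => s; rewrite big_geq.
    by split; [exact: integrable0|rewrite Rintegral_cst// mul0r].
  have -> : (fun s => \sum_(0 <= j < m.+1) v j * u s j) =
      (fun s => \sum_(0 <= j < m) v j * u s j + v m * u s m).
    by apply/funext => s; rewrite big_nat_recr.
  split; first exact: (integrableD _ iS (iZ (v m) m)).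
  by rewrite RintegralD// -ES RintegralZl// big_nat_recr.
have [iS ES] := SE n.
move: t0; rewrite le_eqVlt => /predU1P[t0|t0].
  have -> : S = 0.
    rewrite /S ES /Rintegral null_set_integral//=.
      by case/integrableP: iS.
    by rewrite completed_itv -t0.
  exact: sqr_ge0.
have cS s : s \in `[0, t] -> \sum_(0 <= j < n) v j * u s j <=
    (S + (t * c) ^+ 2) / (2 * t).
  move=> st; have sT : s \in `[0, T].
    by move: st; rewrite !in_itv/= => /andP[-> /le_trans]; exact.
  have us : \sum_(0 <= j < n) u s j ^+ 2 <= c ^+ 2.
    apply: le_trans (le_sum_l2_norm _ _) _.
    have uc := au.2 s sT.
    rewrite lerXn2r ?nnegrE ?l2_norm_ge0//.
    by apply: le_trans uc; exact: l2_norm_ge0.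
  rewrite ler_pdivlMr ?mulr_gt0//.
  apply: (@le_trans _ _ (S + t ^+ 2 * \sum_(0 <= j < n) u s j ^+ 2)); last first.
    by rewrite exprMn lerD2l ler_wpM2l ?sqr_ge0.
  rewrite mulr_suml mulr_sumr -big_split/=; apply: ler_sum => j _.
  rewrite -subr_ge0 (_ : _ - _ = (v j - t * u s j) ^+ 2) ?sqr_ge0//; ring.
have : S <= t * ((S + (t * c) ^+ 2) / (2 * t)).
  rewrite {1}/S ES.
  have -> : t * ((S + (t * c) ^+ 2) / (2 * t)) =
      \int[mu]_(s in `[0, t]) ((S + (t * c) ^+ 2) / (2 * t)).
    by rewrite Rintegral_cst//= completed_itv ?(ltW t0)//= mulrC.
  apply: le_Rintegral => //.
  apply: measurable_bounded_integrable => //.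
    by rewrite /= completed_itv ?ltry// ltW.
  exact: bounded_cst.
have -> : t * ((S + (t * c) ^+ 2) / (2 * t)) = (S + (t * c) ^+ 2) / 2.
  by field; rewrite gt_eqF.
lra.
Qed.
End l2_theory.

(* Main.v *)
(* Let [d = e0 - p0] and [w = e(theta) - e0], the weighted integral of [b]. The
   strategy is the constant control [(d + w) / theta], so it reaches [e(theta)]
   at time [theta]. Minkowski's integral inequality gives
   [|w| <= beta theta^2 / 2]; expanding [|d + w|^2 = |d|^2 + 2 <d, w> + |w|^2]
   and bounding [<d, w> = <d, e(theta)> - <d, e0>] by the half-space condition
   yields exactly [|d + w|^2 <= theta^2 alpha^2]. *)
Require Import Defs.
From mathcomp Require Import all_boot all_order all_algebra.
From mathcomp Require Import all_classical all_reals all_analysis.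
From mathcomp Require Import measurable_realfun ring lra.

Set Implicit Arguments.
Unset Strict Implicit.
Unset Printing Implicit Defensive.

Import Order.TTheory GRing.Theory Num.Theory.
Import numFieldNormedType.Exports.

Local Open Scope classical_set_scope.
Local Open Scope ring_scope.

(** * Inner product, norm and Cauchy-Schwarz inequality in [l2] *)

Section l2_inner_product.
Variable R : realType.
Implicit Types x y z : l2 R.

Lemma l2_ext x y : (forall k, x k = y k) -> x = y.
Proof. by move=> xy; apply: val_inj; apply/funext. Qed.

Lemma l2_addE x y k : (x + y) k = x k + y k.
Proof. by []. Qed.

Lemma l2_scaleE (c : R) x k : (c *: x) k = c * x k.
Proof. by []. Qed.

Lemma l2_dot_cvg x y : cvgn (series (fun k => x k * y k)).
Proof.
(* Polarization: [x y = ((x + y)^2 - x^2 - y^2) / 2]. *)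
rewrite (_ : (fun k => _) = 2^-1 *: ((fun k => (x + y) k ^+ 2)
    - ((fun k => x k ^+ 2) + (fun k => y k ^+ 2)))); last first.
  by apply/funext => k; rewrite !fctE l2_addE /GRing.scale/=; field.
apply: is_cvg_seriesZ; apply: is_cvg_seriesB; first exact: l2_sqr_cvg.
by apply: is_cvg_seriesD; exact: l2_sqr_cvg.
Qed.

Lemma l2_dotC x y : l2_dot x y = l2_dot y x.
Proof.
by rewrite /l2_dot; congr (limn (series _)); apply/funext => k; rewrite mulrC.
Qed.

Lemma l2_dotDl x y z : l2_dot (x + y) z = l2_dot x z + l2_dot y z.
Proof.
rewrite /l2_dot -lim_seriesD; [|exact: l2_dot_cvg..].
by congr (limn (series _)); apply/funext => k; rewrite !fctE l2_addE mulrDl.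
Qed.

Lemma l2_dotDr x y z : l2_dot z (x + y) = l2_dot z x + l2_dot z y.
Proof. by rewrite l2_dotC l2_dotDl !(l2_dotC z). Qed.

Lemma l2_dotZl c x y : l2_dot (c *: x) y = c * l2_dot x y.
Proof.
rewrite /l2_dot -[RHS](lim_seriesZ c (@l2_dot_cvg x y)).
by congr (limn (series _)); apply/funext => k; rewrite l2_scaleE -mulrA.
Qed.

Lemma l2_norm_sqr x : l2_norm x ^+ 2 = l2_dot x x.
Proof.
(* Squaring undoes [Num.sqrt] only on nonnegative numbers, so the limit must be shown nonnegative;
   its partial sums are. *)
rewrite sqr_sqrtr//; apply: limr_ge; first exact: l2_dot_cvg.
by apply: nearW => n; apply: sumr_ge0 => k _; rewrite -expr2 sqr_ge0.
Qed.

Lemma l2_normD_sqr x y :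
  l2_norm (x + y) ^+ 2 = l2_norm x ^+ 2 + 2 * l2_dot x y + l2_norm y ^+ 2.
Proof.
rewrite !l2_norm_sqr l2_dotDl (l2_dotC x) (l2_dotC y) !l2_dotDl (l2_dotC y x).
by ring.
Qed.

Lemma l2_normB_sqr x y :
  l2_norm (x - y) ^+ 2 = l2_norm x ^+ 2 - 2 * l2_dot x y + l2_norm y ^+ 2.
Proof.
rewrite l2_normD_sqr !l2_norm_sqr -scaleN1r l2_dotZl !(l2_dotC _ (-1 *: y)).
by rewrite !l2_dotZl (l2_dotC y x); ring.
Qed.

Lemma l2_normZ c x : l2_norm (c *: x) = `|c| * l2_norm x.
Proof.
apply/eqP; rewrite -(@eqrXn2 _ 2)// ?mulr_ge0 ?l2_norm_ge0//.
rewrite exprMn !l2_norm_sqr real_normK ?num_real//.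
by rewrite l2_dotZl l2_dotC l2_dotZl expr2 mulrA.
Qed.

(** Cauchy-Schwarz for partial sums, the form needed when finite truncations of an inner product are
    integrated. *)
Lemma sum_mul_le_l2_norm x y n :
  \sum_(0 <= k < n) x k * y k <= l2_norm x * l2_norm y.
Proof.
set X := l2_norm x; set Y := l2_norm y.
have X0 : 0 <= X := l2_norm_ge0 x; have Y0 : 0 <= Y := l2_norm_ge0 y.
(* Settles the degenerate cases: when [X] or [Y] is zero, the inequality cannot be scaled by
   [X * Y], but every term of the sum vanishes. *)
have null z w : l2_norm z = 0 -> forall k, z k * w k = 0.
  by move=> z0 k; have := coord_le_l2_norm z k; rewrite z0 normr_le0 => /eqP ->;
    rewrite mul0r.
have [X_eq0|Xn0] := eqVneq X 0.
  by rewrite X_eq0 mul0r big1// => k _; rewrite null.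
have [Y_eq0|Yn0] := eqVneq Y 0.
  by rewrite Y_eq0 mulr0 big1// => k _; rewrite mulrC null.
have XY0 : 0 < X * Y by rewrite mulr_gt0// lt_neqAle eq_sym ?Xn0 ?Yn0.
rewrite -(ler_pM2l XY0) -(ler_pM2l (ltr0n R 2)).
(* AM-GM: [2 X Y x_k y_k <= Y^2 x_k^2 + X^2 y_k^2]. *)
apply: (@le_trans _ _ (Y ^+ 2 * \sum_(0 <= k < n) x k ^+ 2 +
    X ^+ 2 * \sum_(0 <= k < n) y k ^+ 2)).
  rewrite !mulr_sumr -big_split/=; apply: ler_sum => k _.
  rewrite -subr_ge0 (_ : _ - _ = (Y * x k - X * y k) ^+ 2) ?sqr_ge0//; ring.
rewrite (_ : 2 * _ = Y ^+ 2 * X ^+ 2 + X ^+ 2 * Y ^+ 2); last by ring.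
by apply: lerD; apply: ler_wpM2l; rewrite ?sqr_ge0//; exact: le_sum_l2_norm.
Qed.

End l2_inner_product.

(** * Transfer between the Borel and the completed Lebesgue measure *)

Section completed_lebesgue.
Variable R : realType.
Notation mu := (@completed_lebesgue_measure R).

Lemma measurable_lebesgue_type (A : set R) :
  measurable A -> @measurable _ (lebesgue_type R) A.
Proof. exact: sub_caratheodory. Qed.

Lemma measurable_itv_lebesgue_type (i : interval R) :
  @measurable _ (lebesgue_type R) [set` i].
Proof. by apply: measurable_lebesgue_type; exact: measurable_itv. Qed.

Lemma measurable_fun_lebesgue_type (A : set R) (f : R -> R) :
  measurable A -> measurable_fun A f ->
  @measurable_fun _ _ (lebesgue_type R) R A f.
Proof.
by move=> mA mf _ B mB; apply: measurable_lebesgue_type; exact: mf.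
Qed.

Lemma completed_lebesgue_measure_itv (t : R) : 0 <= t -> mu `[0, t] = t%:E.
Proof.
move=> t0; rewrite -[LHS]/(lebesgue_measure `[0, t]) lebesgue_measure_itv/=.
by rewrite lte_fin oppr0 adde0; case: ltgtP t0 => // <-.
Qed.

(** The identity is measurable from the completed sigma-algebra to the Borel one and pushes [mu]
    forward to [lebesgue_measure]. Integrals against [mu] thus come within reach of the fundamental
    theorem of calculus. *)
Lemma ge0_completed_Rintegral (A : set R) (f : R -> R) :
  measurable A -> measurable_fun A f -> {in A, forall x, 0 <= f x} ->
  \int[mu]_(x in A) f x = \int[lebesgue_measure]_(x in A) f x.
Proof.
move=> mA mf f0; rewrite /Rintegral; congr fine.
have mid : @measurable_fun _ _ (lebesgue_type R) (measurableTypeR R) setT idfun.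
  by move=> _ B mB; rewrite setTI; exact: measurable_lebesgue_type.
rewrite -[LHS](ge0_integral_pushforward mid mu (D := A) (f := EFin \o f))//.
exact/measurable_EFinP.
Qed.

Lemma Rintegral_subr_id (T : R) : 0 < T ->
  \int[lebesgue_measure]_(s in `[0, T]) (T - s) = T ^+ 2 / 2.
Proof.
move=> T0; rewrite /Rintegral.
pose F s : R := T * s - s ^+ 2 / 2.
have dF (s : R) : is_derive s 1 F (T - s).
  apply: is_derive_eq; rewrite /GRing.scale/=; by field.
have cF : continuous F.
  by move=> s; apply/differentiable_continuous/derivable1_diffP.
rewrite (@continuous_FTC2 _ _ F)//=.
- by rewrite /F; field.
- apply: continuous_subspaceT => s.
  by apply: cvgB; [exact: cvg_cst|exact: cvg_id].
- split; first by move=> s _; exact: (@ex_derive _ _ _ _ _ _ _ (dF s)).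
    by apply: cvg_at_right_filter; exact: cF.
  by apply: cvg_at_left_filter; exact: cF.
- by move=> s _; rewrite derive1E; exact: (@derive_val _ _ _ _ _ _ _ (dF s)).
Qed.

End completed_lebesgue.

(** * Norm bounds and linearity for the coordinatewise integral *)

Section l2_integral.
Variable R : realType.
Implicit Types (u : R -> l2 R) (T c t : R).
Notation mu := (@completed_lebesgue_measure R).

(** Minkowski's integral inequality, by duality. The majorant [g] may vary with [s]: a constant
    bound on the weighted control would lose a factor 2 in the estimate of the evader's
    displacement. *)
Lemma l2_norm_integral_le T c t u (g : R -> R) :
  admissible_control T c u -> t \in `[0, T] ->
  mu.-integrable `[0, t] (EFin \o g) ->
  (forall s, s \in `[0, t] -> l2_norm (u s) <= g s) ->
  l2_norm (l2_integral `[0, t] u) <= \int[mu]_(s in `[0, t]) g s.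
Proof.
move=> au tT ig ug; set w := l2_integral _ u; set G := Rintegral _ _ _.
have mt : @measurable _ (lebesgue_type R) `[0, t].
  exact: measurable_itv_lebesgue_type.
have iZ (a : R) k : mu.-integrable `[0, t] (EFin \o (fun s => a * u s k)).
  exact: (integrableZl mt a (admissible_integrable k au tT)).
have G0 : 0 <= G.
  apply: Rintegral_ge0 => s st; apply: le_trans (ug _ st); exact: l2_norm_ge0.
(* Only finite truncations of [<w, u s>] are integrated, so linearity suffices and no series is
   exchanged with an integral. *)
have iS n : mu.-integrable `[0, t]
      (EFin \o (fun s => \sum_(0 <= k < n) w k * u s k)) /\
    \sum_(0 <= k < n) w k * w k =
      \int[mu]_(s in `[0, t]) (\sum_(0 <= k < n) w k * u s k).
  elim: n => [|n [iS ES]].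
    rewrite big_geq// (_ : (fun s => _) = cst 0); last first.
      by apply/funext => s; rewrite big_geq.
    by split; [exact: integrable0|rewrite Rintegral_cst// mul0r].
  have -> : (fun s => \sum_(0 <= k < n.+1) w k * u s k) =
      (fun s => \sum_(0 <= k < n) w k * u s k + w n * u s n).
    by apply/funext => s; rewrite big_nat_recr.
  split; first exact: (integrableD _ iS (iZ (w n) n)).
  rewrite RintegralD// -ES RintegralZl//; last exact: (admissible_integrable n au tT).
  by rewrite -(l2_integralE _ au tT) big_nat_recr.
(* Testing the integral against [w] itself: [|w|^2 = int <w, u> <= |w| G]. *)
have wG : l2_norm w ^+ 2 <= l2_norm w * G.
  rewrite l2_norm_sqr; apply: limr_le; first exact: l2_dot_cvg.
  apply: nearW => n; rewrite /series/= (iS n).2 /G -RintegralZl//.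
  apply: le_Rintegral => //.
  - exact: (iS n).1.
  - exact: (integrableZl mt (l2_norm w) ig).
  - move=> s st; apply: le_trans (sum_mul_le_l2_norm _ _ _) _.
    by rewrite ler_wpM2l ?l2_norm_ge0//; exact: ug.
(* If the norm of [w] is zero, the claim is [G0]; otherwise one factor cancels in [wG]. *)
have := l2_norm_ge0 w; rewrite le_eqVlt => /predU1P[<-//|w0].
by move: wG; rewrite expr2 ler_pM2l.
Qed.

Lemma admissible_controlZ T c m (f : R -> R) u :
  measurable_fun `[0, T] f -> (forall s, s \in `[0, T] -> `|f s| <= m) ->
  admissible_control T c u ->
  admissible_control T (m * c) (fun s => f s *: u s).
Proof.
move=> mf fm [mu_ nu]; split=> [k|s sT].
  rewrite (_ : (fun s => _) = f \* (fun s => u s k)); last first.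
    by apply/funext => s; rewrite l2_scaleE.
  apply: measurable_funM; last exact: mu_.
  by apply: measurable_fun_lebesgue_type; first exact: measurable_itv.
by rewrite l2_normZ ler_pM ?l2_norm_ge0 ?fm ?nu.
Qed.

(** The weight is at most [T] on the interval. This crude bound only serves to make the weighted
    integral meaningful coordinatewise; the sharp estimate comes separately. *)
Lemma admissible_control_weighted T c u : admissible_control T c u ->
  admissible_control T (T * c) (fun s => (T - s) *: u s).
Proof.
apply: admissible_controlZ => [|s]; first exact: measurable_funB.
rewrite in_itv/= => /andP[s0 sT].
by rewrite ger0_norm ?subr_ge0// gerBl.
Qed.

Lemma l2_integralZ T c t u (r : R) :
  admissible_control T c u -> t \in `[0, T] ->
  l2_integral `[0, t] (fun s => r *: u s) = r *: l2_integral `[0, t] u.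
Proof.
move=> au tT.
have aru : admissible_control T (`|r| * c) (fun s => r *: u s).
  exact: (admissible_controlZ (f := cst r)).
apply: l2_ext => k; rewrite (l2_integralE k aru tT) l2_scaleE.
rewrite (l2_integralE k au tT) -RintegralZl.
- by apply: eq_Rintegral => s _; rewrite l2_scaleE.
- exact: measurable_itv_lebesgue_type.
- exact: (admissible_integrable k au tT).
Qed.

Lemma l2_integral_cst t (x : l2 R) : 0 <= t ->
  l2_integral `[0, t] (fun=> x) = t *: x.
Proof.
move=> t0; have ac : admissible_control t (l2_norm x) (fun=> x) by split.
apply: l2_ext => k; have tt : t \in `[0, t] by rewrite in_itv/= t0 lexx.
rewrite (l2_integralE k ac tt) Rintegral_cst.
  by rewrite l2_scaleE mulrC /= completed_lebesgue_measure_itv.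
exact: measurable_itv_lebesgue_type.
Qed.

(** Integrating the pointwise majorant [c * (T - s)] exactly produces the factor 1/2, whose square
    is the 1/4 in [Delta]. *)
Lemma l2_norm_weighted_integral T c (b : R -> l2 R) : 0 < T ->
  admissible_control T c b ->
  l2_norm (l2_integral `[0, T] (fun s => (T - s) *: b s)) <= c * T ^+ 2 / 2.
Proof.
move=> T0 ab.
have TT : T \in `[0, T] by rewrite in_itv/= lexx ltW.
have mf : measurable_fun `[0, T] (fun s => T - s) by exact: measurable_funB.
have mT := @measurable_itv R `[0, T].
have iT : mu.-integrable `[0, T] (EFin \o (fun s => T - s)).
  apply: measurable_bounded_integrable.
  - exact: measurable_itv_lebesgue_type.
  - by rewrite /= completed_lebesgue_measure_itv ?ltry// ltW.
  - exact: measurable_fun_lebesgue_type.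
  - exists T; split; first exact: num_real.
    move=> M TM s; rewrite /= in_itv/= => /andP[s0 sT].
    by rewrite ger0_norm ?subr_ge0// (le_trans _ (ltW TM))// gerBl.
have -> : c * T ^+ 2 / 2 = \int[mu]_(s in `[0, T]) (c * (T - s)).
  rewrite RintegralZl//; last exact: measurable_itv_lebesgue_type.
  rewrite ge0_completed_Rintegral// ?Rintegral_subr_id ?mulrA// => s.
  by rewrite inE/= in_itv/= => /andP[_ sT]; rewrite subr_ge0.
apply: (l2_norm_integral_le (admissible_control_weighted ab) TT).
  by apply: (integrableZl _ c iT); exact: measurable_itv_lebesgue_type.
move=> s sT; rewrite l2_normZ mulrC.
have /andP[s0 sT'] : 0 <= s <= T by move: sT; rewrite in_itv.
by rewrite ger0_norm ?subr_ge0// ler_wpM2r ?subr_ge0//; exact: ab.2.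
Qed.

End l2_integral.

(** * Capture at time [theta] by an admissible constant control *)

Theorem lemma3p1 (R : realType) (theta alpha beta : R)
    (theta_gt0 : 0 < theta) (alpha_gt0 : 0 < alpha) (beta_gt0 : 0 < beta)
    (p0 e_0 e_1 : l2 R) (b e : R -> l2 R) :
  let e0 := e_0 + theta *: e_1 in
  admissible_control theta beta b ->
  trajectory theta (fun t => (theta - t) *: b t) e0 e ->
  e theta \in Delta theta alpha beta p0 e0 ->
  let a := strategy theta p0 e0 b in
  (forall t, t \in `[0, theta] -> l2_norm (a t) <= alpha) /\
  (forall p, trajectory theta a p0 p -> p theta = e theta).
Proof.
move=> e0 ab te eD a; clearbody e0.
have TT : theta \in `[0, theta] by rewrite in_itv/= lexx ltW.
have eE := te _ TT.
set w := l2_integral _ _ in eE.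
(* Pulling out [theta^-1] makes the integral in the strategy the same [w] as the evader's
   displacement. *)
have fE : (fun s => ((theta - s) / theta) *: b s) =
    (fun s => theta^-1 *: ((theta - s) *: b s)).
  by apply/funext => s; rewrite scalerA mulrC.
have aE t : a t = theta^-1 *: (e0 - p0 + w).
  rewrite /a /strategy fE.
  rewrite (l2_integralZ theta^-1 (admissible_control_weighted ab) TT).
  by rewrite -scalerDr.
split=> [t _|p tp]; last first.
  (* Integrating the constant control cancels [theta^-1], leaving [p0 + (e0 - p0 + w) = e0 + w]. *)
  rewrite (tp _ TT) eE (_ : a = fun=> theta^-1 *: (e0 - p0 + w)); last first.
    by apply/funext => t; rewrite aE.
  rewrite l2_integral_cst ?ltW// scalerA divff ?gt_eqF// scale1r.
  by rewrite addrA subrKC.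
rewrite aE l2_normZ gtr0_norm ?invr_gt0// ler_pdivrMl//.
have ta0 : 0 <= theta * alpha by rewrite mulr_ge0// ltW.
rewrite -(@ler_pXn2r _ 2)// ?nnegrE ?l2_norm_ge0//.
have w_le : l2_norm w ^+ 2 <= (beta * theta ^+ 2 / 2) ^+ 2.
  have bt0 : 0 <= beta * theta ^+ 2 / 2.
    by rewrite divr_ge0// mulr_ge0 ?sqr_ge0// ltW.
  rewrite ler_pXn2r// ?nnegrE ?l2_norm_ge0//.
  exact: l2_norm_weighted_integral.
move: eD; rewrite inE /Delta/= eE; set d := e0 - p0.
(* Since [p0 = e0 - d], this removes [p0] from the half-space condition; the terms in [e0] then
   cancel, leaving [|d|^2 + 2 <d, w> <= theta^2 alpha^2 - beta^2 theta^4 / 4], to which [w_le] is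
   added. *)
have p0E : l2_norm p0 ^+ 2 = l2_norm e0 ^+ 2 - 2 * l2_dot d e0 + l2_norm d ^+ 2.
  by rewrite (l2_dotC d) -l2_normB_sqr subKr.
rewrite (l2_normD_sqr d w) (l2_dotDr e0 w d) p0E => eD.
lra.
Qed.
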